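(* Let $n\ge 2$, let $T:\mathcal{S}(\mathbb{R}^n)\to\mathcal{S}(\mathbb{R}^n)$ be a rearrangement, and let $f\in\mathcal{S}(\mathbb{R}^n)$. If $\varphi:\mathbb{R}\to\mathbb{R}$ is right-continuous and increasing (i.e., non-decreasing), then $\varphi\circ f\in\mathcal{S}(\mathbb{R}^n)$ and $$\varphi(Tf)=T(\varphi\circ f),$$ essentially. It follows that $T(\alpha f+\beta)=\alpha\,Tf+\beta$, essentially, for all $\alpha,\beta\in\mathbb{R}$ with $\alpha\ge 0$.
   Context: $\mathcal{H}^n$ is $n$-dimensional Hausdorff (Lebesgue) measure on $\mathbb{R}^n$; ''essentially'' means up to a set of $\mathcal{H}^n$-measure zero. $\varphi(Tf)$ denotes the composition $\varphi\circ(Tf)$. $\mathcal{S}(\mathbb{R}^n)$ is the set of real-valued $\mathcal{H}^n$-measurable functions $f$ on $\mathbb{R}^n$ with $\mathcal{H}^n(\{x:f(x)>t\})<\infty$ for all real $t>\operatorname{ess\,inf} f$ (where $\operatorname{ess\,inf} f=-\infty$ is allowed). A map $T:X\to X$ on a set $X$ of measurable functions is equimeasurable if $\mathcal{H}^n(\{x:Tf(x)>t\})=\mathcal{H}^n(\{x:f(x)>t\})$ for all $f\in X$ and $t\in\mathbb{R}$; it is monotonic if for $f,g\in X$, $f\le g$ essentially implies $Tf\le Tg$ essentially; it is a rearrangement if it is equimeasurable and monotonic. *)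

(* Defs.v *)
From HB Require Import structures.
From mathcomp Require Import all_boot all_order all_algebra.
From mathcomp Require Import all_classical all_reals all_analysis.
From mathcomp Require Import ess_sup_inf.

Set Implicit Arguments.
Unset Strict Implicit.
Unset Printing Implicit Defensive.

Import Order.TTheory GRing.Theory Num.Theory.
Import numFieldNormedType.Exports.

Local Open Scope classical_set_scope.
Local Open Scope ring_scope.

Section lebesgue_Rn.
Context {R : realType} {n : nat}.
Implicit Types (B : 'rV[R]_n * 'rV[R]_n) (A : set 'rV[R]_n).

Definition box B : set 'rV[R]_n :=
  [set x | forall i, B.1 0 i <= x 0 i <= B.2 0 i].

(* The truncation at 0 gives an empty box volume 0. *)
Definition box_volume B : R := \prod_(i < n) Num.max 0 (B.2 0 i - B.1 0 i).

Definition box_cover A : set (set ('rV[R]_n * 'rV[R]_n)) :=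
  [set K | countable K /\ A `<=` \bigcup_(B in K) box B].

Definition lebesgue_outer A : \bar R :=
  ereal_inf [set \esum_(B in K) (box_volume B)%:E | K in box_cover A].

Lemma box_volume_ge0 B : (0 <= (box_volume B)%:E)%E.
Proof. by rewrite lee_fin prodr_ge0// => i _; rewrite le_max lexx. Qed.

Let outer0 : lebesgue_outer set0 = 0%E.
Proof.
apply/eqP; rewrite eq_le; apply/andP; split.
  by apply: ereal_inf_lbound; exists set0; [split => //; exact: countable0|
    rewrite esum_set0].
by apply: le_ereal_inf_tmp => _ [K _ <-]; apply: esum_ge0 => B _;
  exact: box_volume_ge0.
Qed.

Let outer_ge0 A : (0 <= lebesgue_outer A)%E.
Proof.
by apply: le_ereal_inf_tmp => _ [K _ <-]; apply: esum_ge0 => B _;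
  exact: box_volume_ge0.
Qed.

Let le_outer : {homo lebesgue_outer : A B / A `<=` B >-> (A <= B)%E}.
Proof.
move=> A B AB; apply/ereal_inf_le_tmp => _ [K [cK BK] <-].
by exists K => //; split => //; exact: subset_trans AB BK.
Qed.

Let outer_sigma_subadditive : sigma_subadditive lebesgue_outer.
Proof.
move=> A; have [[i ioo]|] := pselect (exists i, lebesgue_outer (A i) = +oo%E).
  rewrite (eseries_pinfty _ _ ioo) ?leey// => k _.
  by rewrite -ltNye (lt_le_trans _ (outer_ge0 _)).
rewrite -forallNE => Aoo.
suff add2e (e : {posnum R}) : (lebesgue_outer (\bigcup_k A k) <=
    \sum_(i <oo) lebesgue_outer (A i) + e%:num%:E)%E.
  by apply/lee_addgt0Pr => _/posnumP[].
rewrite (le_trans _ (epsilon_trick _ _ _))//.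
pose P k (K : set ('rV[R]_n * 'rV[R]_n)) := box_cover (A k) K /\
  (\esum_(B in K) (box_volume B)%:E <=
    lebesgue_outer (A k) + (e%:num / (2 ^ k.+1)%:R)%:E)%E.
have [G PG] : {G : nat -> set ('rV[R]_n * 'rV[R]_n) & forall k, P k (G k)}.
  apply: (@choice _ _ P) => k.
  have fin : lebesgue_outer (A k) \is a fin_num.
    by rewrite ge0_fin_numE// ltey; apply/eqP; exact: Aoo.
  have en1 : (0 < e%:num / (2 ^ k.+1)%:R :> R) by [].
  have [_ [K cK <-] KS] := lb_ereal_inf_adherent en1 fin.
  by exists K; split => //; exact: ltW.
apply: (@le_trans _ _ (\esum_(B in \bigcup_k G k) (box_volume B)%:E)).
  apply: ereal_inf_lbound; exists (\bigcup_k G k) => //; split.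
    by apply: bigcup_countable => // k _; case: (PG k) => -[].
  move=> x [k _ Akx]; have [[_ /(_ _ Akx)[B GB Bx]] _] := PG k.
  by exists B => //; exists k.
rewrite seqDU_bigcup_eq esum_bigcupT//; first last.
- by move=> B; exact: box_volume_ge0.
apply: (@le_trans _ _ (\sum_(k <oo) \esum_(B in G k) (box_volume B)%:E)%E).
  rewrite nneseries_esumT; last first.
    by move=> k; apply: esum_ge0 => B _; exact: box_volume_ge0.
  apply: le_esum => k _; rewrite esum_mkcond [leRHS]esum_mkcond; apply: le_esum => B _.
  case: ifPn => [|_]; last by case: ifPn => // _; exact: box_volume_ge0.
  by rewrite inE => /(@subset_seqDU _ G k) /mem_set ->.
apply: lee_nneseries => [k _ _|k _]; last exact: (PG k).2.
by apply: esum_ge0 => B _; exact: box_volume_ge0.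
Qed.

HB.instance Definition _ := isOuterMeasure.Build R 'rV[R]_n lebesgue_outer
  outer0 outer_ge0 le_outer outer_sigma_subadditive.

End lebesgue_Rn.

(* 'rV[R]_n with the sigma-algebra of Lebesgue (not just Borel) measurable
   sets; on R^n the n-dimensional Hausdorff measure is Lebesgue measure. *)
Notation Rn R n := (caratheodory_type (@lebesgue_outer R n)).

Definition lebesgue {R : realType} {n : nat} : set (Rn R n) -> \bar R :=
  @lebesgue_outer R n.

HB.instance Definition _ (R : realType) (n : nat) :=
  isMeasure.Build _ _ _ (@lebesgue R n)
    (@caratheodory_measure0 _ _ (@lebesgue_outer R n))
    (@caratheodory_measure_ge0 _ _ (@lebesgue_outer R n))
    (@caratheodory_measure_sigma_additive _ _ (@lebesgue_outer R n)).

Section rearrangement.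
Context {R : realType} {n : nat}.
Local Notation H := (@lebesgue R n).

Definition S_Rn : set (Rn R n -> R) :=
  [set f | measurable_fun [set: Rn R n] f /\
    forall t : R, (ess_inf H (EFin \o f) < t%:E)%E ->
      (H [set x | (t < f x)%R] < +oo)%E].

Definition equimeasurable (X : set (Rn R n -> R)) (T : {fun X >-> X}) :=
  forall f, X f -> forall t : R, H [set x | t < T f x] = H [set x | t < f x].

Definition monotonic (X : set (Rn R n -> R)) (T : {fun X >-> X}) :=
  forall f g, X f -> X g ->
    (\forall x \ae H, f x <= g x) -> \forall x \ae H, T f x <= T g x.

Definition rearrangement (X : set (Rn R n -> R)) (T : {fun X >-> X}) :=
  equimeasurable T /\ monotonic T.

End rearrangement.

Arguments S_Rn : clear implicits.

(* Main.v *)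
Require Import Defs.
From mathcomp Require Import all_boot all_order all_algebra.
From mathcomp Require Import all_classical all_reals all_analysis.
From mathcomp Require Import measurable_realfun ess_sup_inf.

Set Implicit Arguments.
Unset Strict Implicit.
Unset Printing Implicit Defensive.

Import Order.TTheory GRing.Theory Num.Theory.
Import numFieldNormedType.Exports.

Local Open Scope classical_set_scope.
Local Open Scope ring_scope.

(** A rearrangement T acts on superlevel sets. The central fact is that
inclusions between superlevel sets of finite measure survive T, even when the
two levels differ: if [g > t] is contained in [f > s] and [f > s] has finite
measure, then almost every point of [T g > t] lies in [T f > s]
([rearrangement_level_sub]). Monotonicity alone compares equal levels only;
equimeasurability supplies the rest, because an inclusion between two sets of
the same finite measure is an equality up to a null set. One passes from f to
g through functions that are huge on [f > s] and constant off it: raising or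
lowering that constant changes the base level but not the set.

Given this, T (phi o f) <= phi o T f follows by rational separation. If
phi (T f x) < t < T (phi o f) x, right-continuity of phi provides a rational
r > T f x with phi r < t. Then [phi o f > t] is contained in [f > r], so
T f x > r outside a null set, a contradiction ([rearrangement_comp_le]).
For the converse, [T (phi o f) > t] is now essentially contained in
[phi o T f > t], and it suffices to compare measures. The set of u with
phi u > t is an upper set of the line, so this reduces to the
equimeasurability of f and T f on open and closed half-lines, the closed case
being a limit of open ones ([rearrangement_ge_level]).

The argument works over any measure space. The essential infimum enters only
through the following alternative: t <= ess inf f means that f >= t almost
everywhere, so f belongs to the class S exactly when each level t either
satisfies this or has a superlevel set of finite measure ([S_RnE]). The affine
case is phi y = alpha y + beta. *)

(** * Inclusions up to a null set *)

Section almost_everywhere_inclusion.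
Context d (X : measurableType d) (R : realType).
Context (mu : {measure set X -> \bar R}).
Implicit Types (A B : set X) (f : X -> R).

Lemma measurable_gt_level f t :
  measurable_fun setT f -> measurable [set x | t < f x].
Proof.
move=> mf; rewrite -[X in measurable X]setTI.
have := mf measurableT _ (measurable_itv `]t, +oo[).
by congr (measurable (_ `&` _)); apply/seteqP; split => x /=;
  rewrite in_itv/= andbT.
Qed.

Lemma measurable_ge_level f t :
  measurable_fun setT f -> measurable [set x | t <= f x].
Proof.
move=> mf; rewrite -[X in measurable X]setTI.
have := mf measurableT _ (measurable_itv `[t, +oo[).
by congr (measurable (_ `&` _)); apply/seteqP; split => x /=;
  rewrite in_itv/= andbT.
Qed.

Lemma ae_subset_measureD0 A B : measurable A -> measurable B ->
  (\forall x \ae mu, A x -> B x) -> mu (A `\` B) = 0%E.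
Proof.
move=> mA mB AB; apply: measure_negligible; first exact: measurableD.
by apply: negligibleS AB => x /= [Ax nBx] /(_ Ax).
Qed.

Lemma ae_le_measure A B : measurable A -> measurable B ->
  (\forall x \ae mu, A x -> B x) -> (mu A <= mu B)%E.
Proof.
move=> mA mB AB.
have -> : mu A = (mu (A `\` B) + mu (A `&` B))%E by exact: measureDI.
rewrite ae_subset_measureD0// add0e.
by apply: le_measure; rewrite ?inE//; exact: measurableI.
Qed.

(** The mechanism by which equimeasurability turns the inequalities given by
monotonicity into equalities of sets. Finiteness is what excludes, say, nested
half-lines of infinite length. *)
Lemma ae_subset_eq A B : measurable A -> measurable B ->
  (mu A < +oo)%E -> (mu B <= mu A)%E ->
  (\forall x \ae mu, A x -> B x) -> \forall x \ae mu, B x -> A x.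
Proof.
move=> mA mB Aoo BA AB.
have BD0 : mu (B `\` A) = 0%E.
  have BAoo : (mu (A `&` B) < +oo)%E.
    apply: le_lt_trans Aoo.
    by apply: le_measure; rewrite ?inE//; exact: measurableI.
  have AE : mu A = (mu (A `\` B) + mu (A `&` B))%E by exact: measureDI.
  have BE : mu B = (mu (B `\` A) + mu (B `&` A))%E by exact: measureDI.
  move: BA; rewrite AE (ae_subset_measureD0 mA mB)// add0e BE (setIC B).
  rewrite -[leRHS]add0e leeD2rE ?ge0_fin_numE// => BA.
  by apply/eqP; rewrite eq_le BA measure_ge0.
have : mu.-negligible (B `\` A) by apply/negligibleP => //; exact: measurableD.
by apply: negligibleS => x /= /not_implyP.
Qed.

Lemma ae_forall_count (I : countType) (P : I -> X -> Prop) :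
  (forall i, \forall x \ae mu, P i x) -> \forall x \ae mu, forall i, P i x.
Proof.
move=> aP.
have : \forall x \ae mu, forall n : nat,
    if unpickle n is Some i then P i x else True.
  by apply: ae_foralln => n; case: unpickle => [i|]; [exact: aP|exact: aeW].
by apply: filterS => x Px i; have := Px (pickle i); rewrite pickleK.
Qed.

End almost_everywhere_inclusion.

(** * Right-continuous nondecreasing functions *)

Section monotone.
Context (R : realType).
Implicit Types phi : R -> R.

Lemma ltr_rat_between (a b : R) : a < b -> exists q : rat, a < ratr q < b.
Proof. by move=> /rat_in_itvoo[q]; rewrite in_itv/=; exists q. Qed.

(** Being able to step strictly to the right of y is what makes
right-continuity the right hypothesis: the strict inequality y < q is what
contradicts f >= q. Rationality of q keeps the exceptional null sets
countable in number. *)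
Lemma right_continuous_lt_rat phi y t :
  right_continuous phi -> {homo phi : u v / u <= v} -> phi y < t ->
  exists q : rat, y < ratr q /\ phi (ratr q) < t.
Proof.
move=> rc ndphi yt.
have [z [yz zt]] : exists z, y < z /\ phi z < t.
  have : \forall z \near y^'+, y < z /\ phi z < t.
    near=> z; split; first by near: z; exact: nbhs_right_gt.
    by near: z; apply: cvgr_lt (rc y) _ yt.
  by move=> /filter_ex.
have [q /andP[yq qz]] := ltr_rat_between yz.
by exists q; split => //; apply: le_lt_trans zt; exact/ndphi/ltW.
Unshelve. all: by end_near. Qed.

Lemma nondecreasing_gt_preimage phi t : {homo phi : u v / u <= v} ->
  [\/ forall u, t < phi u, forall u, ~~ (t < phi u),
      exists s, forall u, (t < phi u) = (s < u) |
      exists s, forall u, (t < phi u) = (s <= u)].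
Proof.
move=> ndphi; pose U := [set u | t < phi u].
have upU u v : u <= v -> t < phi u -> t < phi v.
  by move=> uv /lt_le_trans; apply; exact: ndphi.
have [[u Uu]|nU] := pselect (exists u, U u); last first.
  by apply: Or42 => u; apply/negP => Uu; apply: nU; exists u.
have [[l nUl]|aU] := pselect (exists l, ~ U l); last first.
  by apply: Or41 => v; apply: contrapT => nUv; apply: aU; exists v.
have lbU : lbound U l.
  move=> v Uv; rewrite leNgt; apply/negP => vl; apply: nUl.
  by apply: upU Uv; exact: ltW.
have nU0 : U !=set0 by exists u.
have gt_inf v : inf U < v -> t < phi v.
  by move=> /(inf_lt nU0)[w Uw wv]; apply: upU Uw; exact: ltW.
have ge_inf v : t < phi v -> inf U <= v.
  by move=> Uv; apply: ge_inf => //; exists l.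
have [Ui|nUi] := boolP (t < phi (inf U)); [apply: Or44|apply: Or43];
    exists (inf U) => v; apply/idP/idP => //.
- exact: ge_inf.
- by move=> /upU; exact.
- move=> Uv; rewrite lt_neqAle ge_inf// andbT; apply: contraNneq nUi => ->.
  exact: Uv.
- exact: gt_inf.
Qed.

End monotone.

(** * The action of a rearrangement on superlevel sets *)

Section rearrangement_of_levels.
Context d (X : measurableType d) (R : realType).
Context (mu : {measure set X -> \bar R}).
Implicit Types (f g p q : X -> R) (phi : R -> R).

(** The class S over an arbitrary measure space, with the condition
t > ess inf f replaced by the failure of f >= t almost everywhere. *)
Definition finite_levels : set (X -> R) :=
  [set f : X -> R | measurable_fun setT f /\
    forall t, (mu [set x | (t < f x)%R] < +oo)%E \/ \forall x \ae mu, t <= f x].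

(** If some rational q with phi q <= t has a superlevel set [f > q] of finite
measure, that set contains [phi o f > t]. Otherwise f >= q almost everywhere for
all such q, and right-continuity then excludes phi (f x) < t. The critical point
is ess inf f: a function phi that jumps immediately after it could give phi o f a
superlevel set of infinite measure above its own essential infimum. *)
Lemma finite_levels_comp f phi :
  right_continuous phi -> {homo phi : u v / u <= v} ->
  finite_levels f -> finite_levels (phi \o f).
Proof.
move=> rc ndphi [mf hf]; have mphif : measurable_fun setT (phi \o f).
  by apply: measurableT_comp => //; exact: nondecreasing_measurable.
split=> // t.
have [[q [qt qoo]]|nq] := pselect (exists q : rat, phi (ratr q) <= t /\
    (mu [set x | (ratr q < f x)%R] < +oo)%E).
  left; apply: le_lt_trans qoo.
  apply: le_measure; rewrite ?inE; [exact: measurable_gt_level..|].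
  move=> x /= tx; rewrite ltNge; apply: contraTN tx => xq.
  by rewrite -leNgt (le_trans _ qt)//; exact: ndphi.
right.
have : \forall x \ae mu, forall q : rat, phi (ratr q) <= t -> ratr q <= f x.
  apply: ae_forall_count => q; have [qt|/negP nqt] := boolP (phi (ratr q) <= t);
    last by apply: aeW => x ?; case: nqt.
  have [foo|] := hf (ratr q); first by exfalso; apply: nq; exists q.
  exact: filterS.
apply: filterS => x qx; rewrite leNgt; apply/negP => /=.
move=> /(right_continuous_lt_rat rc ndphi)[q [xq qt]].
by have := qx q (ltW qt); rewrite leNgt xq.
Qed.

Context (T : (X -> R) -> (X -> R)).
Context (TS : forall f, finite_levels f -> finite_levels (T f)).
Context (Teq : forall f, finite_levels f -> forall t,
  mu [set x | t < T f x] = mu [set x | t < f x]).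
Context (Tle : forall f g, finite_levels f -> finite_levels g ->
  (\forall x \ae mu, f x <= g x) -> \forall x \ae mu, T f x <= T g x).

Let mlevel f t : finite_levels f -> measurable [set x | t < f x].
Proof. by move=> [mf _]; exact: measurable_gt_level. Qed.

Let mTlevel f t : finite_levels f -> measurable [set x | t < T f x].
Proof. by move=> /TS; exact: mlevel. Qed.

(** Lower bounds are not read off from equimeasurability when the whole space
has infinite measure, since [T f <= u] could be non-null while [T f > u] is
infinite; it is the membership of T f in the class S that forbids this. When
[T f > u] has finite measure, so has the space, and complements can be
compared. *)
Lemma rearrangement_ae_ge f t : finite_levels f ->
  (\forall x \ae mu, t <= f x) -> \forall x \ae mu, t <= T f x.
Proof.
move=> Sf tf.
suff : \forall x \ae mu, forall q : rat, ratr q < t -> ratr q <= T f x.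
  apply: filterS => x qx; rewrite leNgt; apply/negP.
  move=> /ltr_rat_between[q /andP[xq qt]].
  by have := qx q qt; rewrite leNgt xq.
apply: ae_forall_count => q.
have [qt|/negP nqt] := boolP (ratr q < t); last by apply: aeW => x ?; case: nqt.
have [qoo|] := (TS Sf).2 (ratr q); last exact: filterS.
have qT : (mu setT <= mu [set x | (ratr q < T f x)%R])%E.
  rewrite Teq//; apply: ae_le_measure => //; first exact: mlevel.
  by apply: filterS tf => x tx _; exact: lt_le_trans tx.
have := ae_subset_eq (mTlevel (ratr q) Sf) measurableT qoo qT.
by move=> /(_ (aeW mu (fun _ _ => I))); apply: filterS => x /(_ I) /ltW.
Qed.

Lemma rearrangement_same_level p q s t : finite_levels p -> finite_levels q ->
  (mu [set x | (s < p x)%R] < +oo)%E ->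
  [set x | t < q x] `<=` [set x | s < p x] ->
  (\forall x \ae mu, s < T p x -> t < T q x) ->
  \forall x \ae mu, t < T q x -> s < T p x.
Proof.
move=> Sp Sq poo qp.
apply: ae_subset_eq; [exact: mTlevel|exact: mTlevel|by rewrite Teq|].
by rewrite !Teq//; apply: le_measure; rewrite ?inE//; exact: mlevel.
Qed.

(** With F = [f > s], let P c equal c off F and a function above M, f and g
on F, where M is the larger of s and t. All of [P c > u] for c <= u <= M are
equal to F, so the levels of T (P s), T (P M) and T (P t) can be identified;
f <= P s and g <= P t tie in the two given functions. *)
Lemma rearrangement_level_sub f g s t : finite_levels f -> finite_levels g ->
  (mu [set x | (s < f x)%R] < +oo)%E ->
  [set x | t < g x] `<=` [set x | s < f x] ->
  \forall x \ae mu, t < T g x -> s < T f x.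
Proof.
move=> Sf Sg foo gf.
pose M := Num.max s t.
have sM : s <= M by rewrite le_max lexx.
have tM : t <= M by rewrite le_max lexx orbT.
pose P c := fun x => if s < f x
  then Num.max (M + 1) (Num.max (f x) (g x)) else c.
have PF c u x : c <= u -> u < P c x -> s < f x.
  by rewrite /P; case: ifP => // _ cu /(le_lt_trans cu); rewrite ltxx.
have FP c u x : u <= M -> s < f x -> u < P c x.
  move=> uM sfx; rewrite /P sfx lt_max (le_lt_trans uM)// ltrDl//.
have SP c : c <= M -> finite_levels (P c).
  move=> cM; have mP : measurable_fun setT (P c).
    apply: measurable_fun_ifT => //.
      by apply: measurable_fun_ltr => //; exact: Sf.1.
    apply: measurable_maxr => //; apply: measurable_maxr.
      exact: Sf.1.
    exact: Sg.1.
  split => // u; have [cu|uc] := leP c u.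
    left; apply: le_lt_trans foo; apply: le_measure; rewrite ?inE.
    - exact: measurable_gt_level.
    - exact: mlevel.
    - by move=> x /=; exact: PF.
  right; apply: aeW => x; apply: ltW; have [sfx|nsfx] := boolP (s < f x).
    by apply: FP => //; exact: ltW (lt_le_trans uc cM).
  by rewrite /P (negbTE nsfx).
have Poo c u : c <= M -> c <= u -> (mu [set x | (u < P c x)%R] < +oo)%E.
  move=> cM cu; apply: le_lt_trans foo; apply: le_measure; rewrite ?inE.
  - exact/mlevel/SP.
  - exact: mlevel.
  - by move=> x /=; exact: PF.
have SPs := SP _ sM; have SPt := SP _ tM; have SPM := SP _ (lexx M).
(* f <= P s, and both have F as superlevel set at s. *)
have f_Ps : \forall x \ae mu, s < T (P s) x -> s < T f x.
  apply: rearrangement_same_level => // [x|]; first exact: PF.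
  have : \forall x \ae mu, T f x <= T (P s) x.
    apply: Tle => //; apply: aeW => x; rewrite /P; case: ltP => // _.
    by rewrite !le_max lexx orbT.
  by apply: filterS => x /[swap]; exact: lt_le_trans.
(* At the common level M the value off F can be raised from s to M. *)
have Ps_PM : \forall x \ae mu, M < T (P M) x -> M < T (P s) x.
  apply: rearrangement_same_level => //; first exact: Poo.
    by move=> x /= /PF => /(_ (lexx M)); exact: FP.
  have : \forall x \ae mu, T (P s) x <= T (P M) x.
    by apply: Tle => //; apply: aeW => x; rewrite /P; case: ifP.
  by apply: filterS => x /[swap]; exact: lt_le_trans.
(* It can then be lowered from M to t. *)
have Pt_PM : \forall x \ae mu, T (P t) x <= T (P M) x.
  by apply: Tle => //; apply: aeW => x; rewrite /P; case: ifP.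
(* No value of P t lies strictly between t and M, so T does not separate
   these two levels. *)
have Pt_M : \forall x \ae mu, t < T (P t) x -> M < T (P t) x.
  apply: rearrangement_same_level => //; first exact: Poo.
    by move=> x /= /PF => /(_ (lexx t)); exact: FP.
  by apply: aeW => x; exact: le_lt_trans.
have g_Pt : \forall x \ae mu, T g x <= T (P t) x.
  apply: Tle => //; apply: aeW => x; rewrite /P; case: ifP => [_|/negP nf].
    by rewrite !le_max lexx !orbT.
  by rewrite leNgt; apply/negP => /gf.
near=> x => tx.
have {}tx : t < T (P t) x by apply: lt_le_trans tx _; near: x.
have Mt : M < T (P t) x by move: tx; near: x.
have {}Mt : M < T (P M) x by apply: lt_le_trans Mt _; near: x.
have {}Mt : M < T (P s) x by move: Mt; near: x.
by have := le_lt_trans sM Mt; near: x.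
Unshelve. all: by end_near. Qed.

(** Key: for rationals r and t with phi r < t, the inclusion of [phi o f > t]
in [f > r] passes to T. If [f > r] has infinite measure, then f >= r almost
everywhere and hence T f >= r. *)
Lemma rearrangement_comp_le f phi :
  right_continuous phi -> {homo phi : u v / u <= v} -> finite_levels f ->
  \forall x \ae mu, T (phi \o f) x <= phi (T f x).
Proof.
move=> rc ndphi Sf; have Sphif := finite_levels_comp rc ndphi Sf.
have key : \forall x \ae mu, forall rt : rat * rat,
    phi (ratr rt.1) < ratr rt.2 ->
    ratr rt.2 < T (phi \o f) x -> ratr rt.1 <= T f x.
  apply: ae_forall_count => -[r t] /=.
  have [rt|/negP nrt] := boolP (phi (ratr r) < ratr t);
    last by apply: aeW => x ?; case: nrt.
  have [foo|fr] := Sf.2 (ratr r); last first.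
    by apply: filterS (rearrangement_ae_ge Sf fr).
  have : \forall x \ae mu, ratr t < T (phi \o f) x -> ratr r < T f x.
    apply: rearrangement_level_sub => // x /= tx.
    rewrite ltNge; apply/negP => /ndphi xr.
    by have := lt_trans (le_lt_trans xr rt) tx; rewrite ltxx.
  by apply: filterS => x h _ /h /ltW.
apply: filterS key => x key; rewrite leNgt; apply/negP.
move=> /ltr_rat_between[t /andP[xt tx]].
have [r [xr rt]] := right_continuous_lt_rat rc ndphi xt.
by have := key (r, t) rt tx; rewrite leNgt xr.
Qed.

(** Continuity from above along open levels increasing to s, started at the
level r of finite measure. *)
Lemma rearrangement_ge_level f r s : finite_levels f -> r < s ->
  (mu [set x | (r < f x)%R] < +oo)%E ->
  (mu [set x | (s <= T f x)%R] <= mu [set x | (s <= f x)%R])%E.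
Proof.
move=> Sf rs roo.
pose a k : R := s - (s - r) * k.+1%:R^-1.
have a_lt k : a k < s by rewrite /a ltrBlDr ltrDl mulr_gt0 ?invr_gt0 ?subr_gt0.
have a_ge k : r <= a k.
  rewrite /a lerBrDr addrC -lerBrDr ler_piMr ?subr_ge0 ?(ltW rs)//.
  by rewrite invf_le1// ler1n.
have a_nd : {homo a : i j / (i <= j)%N >-> i <= j}.
  move=> i j ij; rewrite /a lerD2l lerN2 ler_wpM2l ?subr_ge0 ?(ltW rs)//.
  by rewrite lef_pV2 ?posrE// ler_nat ltnS.
have a_cvg : a @ \oo --> s.
  rewrite -[X in _ --> X]subr0 -(mulr0 (s - r)).
  apply: cvgB; first exact: cvg_cst.
  by apply: cvgMr; exact: cvg_harmonic.
pose F k := [set x | a k < f x].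
have mF k : measurable (F k) by exact: mlevel.
have capF : \bigcap_k F k = [set x | s <= f x].
  apply/seteqP; split => x /= sx; last by move=> k _; exact: lt_le_trans sx.
  have := a_cvg => /cvg_lim <-//; apply: limr_le; first by apply/cvgP: a_cvg.
  by apply: nearW => k; exact/ltW/(sx k).
have : mu \o F @ \oo --> mu (\bigcap_k F k).
  apply: nonincreasing_cvg_mu => //.
  - apply: le_lt_trans roo; apply: le_measure; rewrite ?inE//.
      exact: mlevel.
    by move=> x /=; exact: le_lt_trans.
  - exact: bigcap_measurable.
  - move=> i j ij; apply/subsetPset => x /=; apply: le_lt_trans.
    exact: a_nd.
rewrite capF => cvgF; rewrite -(cvg_lim _ cvgF)//.
apply: lime_ge; first by apply/cvgP: cvgF.
apply: nearW => k /=; rewrite /F -Teq//.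
apply: le_measure; rewrite ?inE.
- by apply: measurable_ge_level; have [] := TS Sf.
- exact: mTlevel.
- by move=> x /=; exact: lt_le_trans.
Qed.

(** * Composition with a right-continuous nondecreasing function *)

Theorem rearrangement_comp f phi :
  right_continuous phi -> {homo phi : u v / u <= v} -> finite_levels f ->
  phi \o T f = T (phi \o f) %[ae mu].
Proof.
move=> rc ndphi Sf; have Sphif := finite_levels_comp rc ndphi Sf.
have le := rearrangement_comp_le rc ndphi Sf.
have mphiT : measurable_fun setT (phi \o T f).
  apply: measurableT_comp; first exact: nondecreasing_measurable.
  by have [] := TS Sf.
suff ge : \forall x \ae mu, forall q : rat,
    ratr q < phi (T f x) -> ratr q <= T (phi \o f) x.
  near=> x => _ /=; apply/eqP; rewrite eq_le; apply/andP; split; last by near: x.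
  rewrite leNgt; apply/negP => /ltr_rat_between[q /andP[xq qx]].
  suff : ratr q <= T (phi \o f) x by rewrite leNgt xq.
  by move: q qx {xq}; near: x.
apply: ae_forall_count => q; set t : R := ratr q.
have [toft|] := Sphif.2 t; last first.
  by move=> /(rearrangement_ae_ge Sphif); apply: filterS => x.
(* If phi o f > t almost everywhere, f need not have any level of finite
   measure below the endpoint of [phi > t], so this case is set apart; T
   preserves the lower bound t. *)
have [full|nfull] := pselect (\forall x \ae mu, t < phi (f x)).
  have : \forall x \ae mu, t <= T (phi \o f) x.
    by apply: rearrangement_ae_ge => //; apply: filterS full => x /ltW.
  exact: filterS.
suff : \forall x \ae mu, t < phi (T f x) -> t < T (phi \o f) x.
  by apply: filterS => x tx /tx /ltW.
apply: (@ae_subset_eq _ _ _ _ [set x | t < T (phi \o f) x]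
  [set x | t < phi (T f x)]).
- exact: mTlevel.
- exact: measurable_gt_level.
- by rewrite Teq.
- rewrite Teq//.
  have [U|U|[s U]|[s U]] := nondecreasing_gt_preimage t ndphi.
  + by exfalso; apply: nfull; apply: aeW => x; exact: U.
  + rewrite (_ : [set x | _] = set0) ?measure0 ?measure_ge0//.
    by apply/seteqP; split => // x /=; rewrite (negbTE (U _)).
  + rewrite (_ : [set x | _] = [set x | s < T f x]); last first.
      by apply/seteqP; split => x /=; rewrite U.
    rewrite Teq// le_eqVlt; apply/orP; left; apply/eqP; congr (mu _).
    by apply/seteqP; split => x /=; rewrite U.
  + have [[r [rs roo]]|nr] := pselect (exists r : rat, ratr r < s /\
        (mu [set x | (ratr r < f x)%R] < +oo)%E).
      have := rearrangement_ge_level Sf rs roo.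
      by congr (_ <= _)%E; congr (mu _); apply/seteqP; split => x /=; rewrite U.
    (* With no finite level below s, f >= s almost everywhere. *)
    exfalso; apply: nfull.
    have : \forall x \ae mu, forall r : rat, ratr r < s -> ratr r <= f x.
      apply: ae_forall_count => r; have [rs|/negP nrs] := boolP (ratr r < s);
        last by apply: aeW => x ?; case: nrs.
      have [roo|] := Sf.2 (ratr r); first by exfalso; apply: nr; exists r.
      exact: filterS.
    apply: filterS => x rx; rewrite U leNgt; apply/negP.
    move=> /ltr_rat_between[r /andP[xr rs]].
    by have := rx r rs; rewrite leNgt xr.
- by apply: filterS le => x /[swap]; exact: lt_le_trans.
Unshelve. all: by end_near. Qed.

End rearrangement_of_levels.

Lemma S_RnE (R : realType) (n : nat) :
  S_Rn R n = finite_levels (@lebesgue R n).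
Proof.
apply/seteqP; split=> f [mf hf]; split => // t.
  have [/hf|/ess_infP tf] := ltP (ess_inf (@lebesgue R n) (EFin \o f)) t%:E.
    by left.
  by right; apply: filterS tf => x; rewrite lee_fin.
have [//|tf] := hf t; rewrite ltNge => /negP tess; exfalso; apply: tess.
by apply/ess_infP; apply: filterS tf => x; rewrite lee_fin.
Qed.

Theorem theorem4p9 (R : realType) (n : nat) (hn : (2 <= n)%N)
    (T : {fun S_Rn R n >-> S_Rn R n}) (hT : rearrangement T)
    (f : Rn R n -> R) (hf : S_Rn R n f) :
  (forall phi : R -> R,
      right_continuous phi -> {homo phi : x y / x <= y} ->
      S_Rn R n (phi \o f) /\
      (phi \o T f = T (phi \o f) %[ae lebesgue])) /\
  (forall alpha beta : R, 0 <= alpha ->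
      T (fun x => alpha * f x + beta) = (fun x => alpha * T f x + beta)
        %[ae lebesgue]).
Proof.
have main (phi : R -> R) : right_continuous phi -> {homo phi : x y / x <= y} ->
    S_Rn R n (phi \o f) /\ (phi \o T f = T (phi \o f) %[ae lebesgue]).
  move=> rc ndphi; have [Teq Tle] := hT; pose S := finite_levels (@lebesgue R n).
  have SE : S_Rn R n = S := S_RnE R n.
  have Sf : S f by rewrite -SE.
  split; first by rewrite SE; exact: finite_levels_comp.
  apply: (@rearrangement_comp _ _ _ (@lebesgue R n)) => // g.
  - by rewrite -/S -SE; exact: funS.
  - by rewrite -/S -SE; exact: Teq.
  - by move=> h; rewrite -/S -SE; exact: Tle.
split=> // alpha beta alpha0.
have [||_] := main (fun y => alpha * y + beta).
- apply: right_continuousW => x; apply: cvgD; last exact: cvg_cst.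
  by apply: cvgMr; exact: cvg_id.
- by move=> x y xy; rewrite lerD2r ler_wpM2l.
- by apply: filterS => x /(_ I) /= <-.
Qed.
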